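(* Let $S\subset\mathbb{R}^n$ be a nonempty semi-algebraic set, $f\colon\mathbb{R}^n\to\mathbb{R}\cup\{\infty\}$ a semi-algebraic function such that $f_* := \inf_{x\in S} f(x)$ is finite, and $\psi\colon\mathbb{R}^n\to\mathbb{R}_+$ a semi-algebraic residual function for $S$. If $f$ is bounded from below on $\mathbb{R}^n$, then the following properties are equivalent: (i) there exist constants $c_*>0$ and $\alpha\in(0,1]$ such that for all $c>c_*$, $\inf_{x\in S} f(x)=\inf_{x\in\mathbb{R}^n}\{f(x)+c\,[\psi(x)]^\alpha\}$; (ii) there exist constants $c_*>0$ and $\alpha\in(0,1]$ such that $c_*[\psi(x)]^\alpha\ge[f_*-f(x)]_+$ for all $x\in\mathbb{R}^n$; (iii) for any sequence of points $x_k$ in $\mathbb{R}^n$ with $\psi(x_k)\to0$, one has $[f_*-f(x_k)]_+\to0$. When these equivalent properties hold, one has moreover (with $c_*$ and $\alpha$ as in (i) or (ii)) for all $c>c_*$ that $$\mathrm{argmin}_S f(x)=\mathrm{argmin}_{\mathbb{R}^n}\{f(x)+c\,[\psi(x)]^\alpha\}.$$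
   Context: $\mathbb{R}_+ := [0,\infty)$ and $[r]_+ := \max\{r,0\}$ (with $[f_*-f(x)]_+=0$ if $f(x)=\infty$). A subset of $\mathbb{R}^n$ is semi-algebraic if it is a finite union of sets each defined by finitely many polynomial equations and strict inequalities; a function $h\colon X\to\mathbb{R}\cup\{\infty\}$ is semi-algebraic if $\{(x,y)\in X\times\mathbb{R}\mid y=h(x)\}$ is semi-algebraic. A residual function of $S$ is a function $\psi\colon\mathbb{R}^n\to\mathbb{R}_+$ such that $\psi(x)=0$ if and only if $x\in S$. No continuity of $f$ or $\psi$ and no closedness of $S$ is assumed. $\mathrm{argmin}$ denotes the set of points of the indicated set at which the (finite) infimum is attained (possibly empty). *)

(* Defs.v *)
From mathcomp Require Import all_boot all_order all_algebra.
From mathcomp Require Import all_classical all_reals all_analysis.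
(* Not imported: the notations of [mpoly] clash with those of the analysis
   library. *)
From mathcomp Require mpoly.

Set Implicit Arguments.
Unset Strict Implicit.
Unset Printing Implicit Defensive.

Import Order.TTheory GRing.Theory Num.Theory.
Import numFieldNormedType.Exports.

Local Open Scope classical_set_scope.
Local Open Scope ring_scope.

(* Each member [d] of [D] is one piece of the union: [d.1] lists the polynomials
   required to vanish, [d.2] those required to be positive. *)
Definition semialgebraic_set (R : realType) (n : nat) (A : set 'rV[R]_n) : Prop :=
  exists D : seq (seq (mpoly.mpoly n R) * seq (mpoly.mpoly n R)),
    A = [set x : 'rV[R]_n |
          has (fun d =>
                 all (fun p => mpoly.meval (fun i => x ord0 i) p == 0) d.1 &&
                 all (fun q => 0 < mpoly.meval (fun i => x ord0 i) q) d.2) D].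

(* R^n x R is 'rV[R]_(n + 1), the last coordinate being the value: points where
   h is infinite do not contribute to the graph. *)
Definition real_graph (R : realType) (n : nat) (h : 'rV[R]_n -> \bar R) :
    set 'rV[R]_(n + 1) :=
  [set z | (rsubmx z ord0 ord0)%:E = h (lsubmx z)].

Definition semialgebraic_fun (R : realType) (n : nat) (h : 'rV[R]_n -> \bar R) :
    Prop :=
  semialgebraic_set (real_graph h).

Definition residual_function (R : realType) (n : nat) (S : set 'rV[R]_n)
    (psi : 'rV[R]_n -> R) : Prop :=
  (forall x, 0 <= psi x) /\ (forall x, psi x = 0 <-> S x).

Definition inf_on (R : realType) (T : Type) (A : set T) (g : T -> \bar R) : \bar R :=
  ereal_inf [set g x | x in A].

Definition argmin (R : realType) (T : Type) (A : set T) (g : T -> \bar R) : set T :=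
  [set x | A x /\ g x = inf_on A g].

Definition penalized (R : realType) (T : Type) (f : T -> \bar R) (psi : T -> R)
    (alpha c : R) (x : T) : \bar R :=
  (f x + (c * psi x `^ alpha)%:E)%E.

(* The positive part of f_* - f x; it is 0 when f x = +oo, since then
   f_* - f x = -oo for f_* finite. *)
Definition gap (R : realType) (T : Type) (S : set T) (f : T -> \bar R) (x : T) :
    \bar R :=
  maxe (inf_on S f - f x)%E 0%E.

Definition exact_penalty (R : realType) (T : Type) (S : set T) (f : T -> \bar R)
    (psi : T -> R) (cstar alpha : R) : Prop :=
  forall c : R, cstar < c ->
    inf_on S f = inf_on [set: T] (penalized f psi alpha c).

Definition error_bound (R : realType) (T : Type) (S : set T) (f : T -> \bar R)
    (psi : T -> R) (cstar alpha : R) : Prop :=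
  forall x : T, (gap S f x <= (cstar * psi x `^ alpha)%:E)%E.

(* Main.v *)
Require Import Defs.
From mathcomp Require Import all_boot all_order all_algebra.
From mathcomp Require Import all_classical all_reals all_analysis.
From mathcomp Require mpoly.
From mathcomp Require Import polyrcf ordered_qelim qe_rcf.
From mathcomp Require Import zify ring lra.

Set Implicit Arguments.
Unset Strict Implicit.

Import Order.TTheory GRing.Theory Num.Theory.
Import numFieldNormedType.Exports.

Local Open Scope classical_set_scope.
Local Open Scope ring_scope.

(** Write [fs] for the infimum of [f] on [S] and [g = [fs - f]_+].

    (i) and (ii) are the same inequality read twice: (ii) for a constant [c]
    says that [fs <= f + c psi^alpha] everywhere, that is, that [fs] is at most
    the infimum of the penalized function; the reverse inequality always holds
    because the penalty vanishes on [S].  Letting [c] decrease to [cstar] in (i)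
    recovers (ii) for [cstar] itself.  If a minimizer of the penalized function
    for some [c > cstar] had [psi > 0], lowering [c] to [cstar] would strictly
    lower the value at that point below [fs], against (ii); so all minimizers
    lie in [S].

    The content is (iii) => (ii), a Lojasiewicz inequality: [g <= C psi^alpha]
    where [psi] is small (where [psi] is bounded away from 0, boundedness of [f]
    from below suffices).  Consider the set [H] of pairs [(t, y)] for which some
    [x] satisfies [psi x = t] and [f x + y <= fs].  It is a first-order
    definable subset of the plane ([gap_formula]) whose fibres [H t] are closed
    downwards, and (iii) says that [sup (H t)] is small when [t] is.

    By quantifier elimination over the reals, [H] is given by a quantifier-free
    formula.  Away from the zeros of the product [P] of the nonzero polynomials
    in its atoms, the truth of this formula is locally constant in [y]
    ([qf_eval_near]).  At [y = sup (H t)] it is not, so [P(t, sup (H t)) = 0]: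
    the boundary of [H] lies on an algebraic curve.

    A nonzero polynomial [P] has the form [t^j (y^k u(y) + t Q(t, y))] with
    [u(0) != 0], so on its zeros with [t > 0] and [y] close to 0,
    [y^k |u(y)| = t |Q(t, y)|], hence [y^k = O(t)] ([polynomial_curve_holder]).
    This is the required bound, with exponent [1 / (k + 1)]; passing from [k]
    to [k + 1] costs nothing as [y <= 1] and covers [k = 0]. *)

(** * First-order formulas over the reals *)

Lemma quantifier_elimination (R : rcfType) (F : ord.formula R) :
  exists G : ord.formula R,
    [/\ ord.qf_form G, ord.rformula G &
        forall e, ord.holds e F <-> ord.qf_eval e G].
Proof.
exists (ord.quantifier_elim (@wproj R) (ord.to_rform F)).
have /andP[qfG rG] := ord.quantifier_elim_wf (@wf_QE_wproj R)
  (ord.to_rform_rformula F).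
by split=> // e; split=> [/rcf_satP|/rcf_satP].
Qed.

Definition exists_vars (R : Type) (vs : seq nat) (F : ord.formula R) :=
  foldr ord.Exists F vs.

(** An environment of evaluation is only read through [nth 0], so quantifying
    over several variables amounts to choosing a new environment that agrees
    with the old one on all the others. *)
Lemma holds_exists_vars (R : realDomainType) (vs : seq nat) (F : ord.formula R)
    (e : seq R) :
  ord.holds e (exists_vars vs F) <->
  exists2 e', (forall i, i \notin vs -> e'`_i = e`_i) & ord.holds e' F.
Proof.
elim: vs e => [|v vs IH] e /=.
  split=> [Fe|[e' ee' Fe']]; first by exists e.
  by apply: ord.eq_holds Fe' => i; apply: ee'.
split=> [[x /IH[e' ee' Fe']]|[e' ee' Fe']].
  exists e' => // i; rewrite inE negb_or => /andP[iv ivs].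
  by rewrite ee' // nth_set_nth /= (negbTE iv).
exists e'`_v; apply/IH; exists e' => // i ivs.
rewrite nth_set_nth /=; have [->//|iv] := eqVneq i v.
by rewrite ee' // inE negb_or iv.
Qed.

Definition term_of_mpoly (R : realType) (m : nat) (rho : 'I_m -> nat)
    (p : mpoly.mpoly m R) : GRing.term R :=
  foldr (fun d t => GRing.Add
      (GRing.Mul (GRing.Const (mpoly.mcoeff d p))
        (foldr (fun i u => GRing.Mul
           (GRing.Exp (GRing.Var R (rho i)) (mpoly.fun_of_multinom d i)) u)
           (GRing.NatConst R 1) (index_enum 'I_m))) t)
    (GRing.NatConst R 0) (mpoly.msupp p).

Lemma eval_term_of_mpoly (R : realType) (m : nat) (rho : 'I_m -> nat)
    (p : mpoly.mpoly m R) (e : seq R) :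
  GRing.eval e (term_of_mpoly rho p) = mpoly.meval (fun i => e`_(rho i)) p.
Proof.
rewrite mpoly.mevalE /term_of_mpoly.
elim: (mpoly.msupp p) => [|d s IH] /=; first by rewrite big_nil.
rewrite big_cons IH; congr (_ * _ + _).
elim: (index_enum _) => [|i r IHr] /=; first by rewrite big_nil.
by rewrite big_cons IHr.
Qed.

(** The renaming [rho] makes it possible to place the graphs of two functions in
    one environment with their point [x] shared and their values apart. *)
Lemma semialgebraic_formula (R : realType) (m : nat) (A : set 'rV[R]_m)
    (rho : 'I_m -> nat) :
  semialgebraic_set A ->
  exists F : ord.formula R, forall e,
    ord.holds e F <-> A (\row_i e`_(rho i)).
Proof.
move=> [D ->].
pose pos q := ord.Lt (GRing.NatConst R 0) (term_of_mpoly rho q).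
pose zero p := ord.Equal (term_of_mpoly rho p) (GRing.NatConst R 0).
pose conj (at_ : mpoly.mpoly m R -> ord.formula R) s :=
  foldr (fun p => ord.And (at_ p)) (ord.Bool true) s.
exists (foldr (fun d => ord.Or (ord.And (conj zero d.1) (conj pos d.2)))
  (ord.Bool false) D) => e.
have evalE p : mpoly.meval (fun i => (\row_i e`_(rho i)) ord0 i) p =
    GRing.eval e (term_of_mpoly rho p).
  by rewrite eval_term_of_mpoly; apply: mpoly.meval_eq => i; rewrite mxE.
have conjP at_ (P : pred (mpoly.mpoly m R)) s :
    (forall p, ord.holds e (at_ p) <-> P p) ->
    ord.holds e (conj at_ s) <-> all P s.
  move=> atP; elim: s => //= p s IH.
  by rewrite IH atP; split=> [/andP|/andP].
have zeroP p : ord.holds e (zero p) <->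
    mpoly.meval (fun i => (\row_i e`_(rho i)) ord0 i) p == 0.
  by rewrite evalE; split=> [/eqP|/eqP].
have posP q : ord.holds e (pos q) <->
    0 < mpoly.meval (fun i => (\row_i e`_(rho i)) ord0 i) q by rewrite evalE.
rewrite /=; elim: D => //= d D IH.
rewrite (conjP _ _ d.1 zeroP) (conjP _ _ d.2 posP) IH.
by split=> [[/andP->//|->]|/orP[/andP|]]; rewrite ?orbT //; [left|right].
Qed.

(** * Quantifier-free formulas in two variables *)

(** The outer indeterminate stands for [t], the inner one for [y]: factoring out
    powers of [t] is then univariate factorization over the ring [{poly R}]. *)
Definition heval2 (R : comNzRingType) (P : {poly {poly R}}) (t y : R) : R :=
  P.[t%:P].[y].

Lemma rterm_poly2 (R : realDomainType) (u : GRing.term R) :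
  GRing.rterm u ->
  exists P : {poly {poly R}}, forall t y : R,
    heval2 P t y = GRing.eval [:: t; y] u.
Proof.
rewrite /heval2; elim: u => //=.
- case=> [|[|n]] _; first by exists 'X => t y; rewrite hornerX hornerC.
  + by exists ('X%:P) => t y; rewrite hornerC hornerX.
  + by exists 0 => t y; rewrite !horner0; case: n.
- by move=> c _; exists (c%:P%:P) => t y; rewrite !hornerC.
- by move=> k _; exists (k%:R) => t y;
  rewrite -polyC_natr hornerC -polyC_natr hornerC.
- move=> u IHu v IHv /andP[/IHu[P PE] /IHv[Q QE]].
  by exists (P + Q) => t y; rewrite !hornerD PE QE.
- by move=> u IHu /IHu[P PE]; exists (- P) => t y; rewrite !hornerN PE.
- by move=> u IHu k /IHu[P PE]; exists (P *+ k) => t y; rewrite !hornerMn PE.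
- move=> u IHu v IHv /andP[/IHu[P PE] /IHv[Q QE]].
  by exists (P * Q) => t y; rewrite !hornerM PE QE.
- by move=> u IHu k /IHu[P PE]; exists (P ^+ k) => t y; rewrite !horner_exp PE.
Qed.

Lemma horner_sgr_near (R : realType) (p : {poly R}) (y : R) :
  p.[y] != 0 -> \forall z \near y, Num.sg p.[z] = Num.sg p.[y].
Proof.
move=> py0; have [|d d0 pd] := @poly_cont R y p `|p.[y]|.
  by rewrite normr_gt0.
apply/nbhs_ballP; exists d => //= z; rewrite /ball /= distrC => /pd.
rewrite ltr_distl; case: (ltgtP p.[y] 0) py0 => // py _.
- by rewrite ltr0_norm // opprK subrr => /andP[_ pz]; rewrite !ltr0_sg.
- by rewrite gtr0_norm // subrr => /andP[pz _]; rewrite !gtr0_sg.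
Qed.

(** The sign of a polynomial is locally constant off its zeros, and everywhere
    if the polynomial is zero; in the latter case [P = 1] is the witness, since
    [P] must be nonzero. *)
Lemma rterm_difference_sgr_near (R : realType) (u v : GRing.term R) :
  GRing.rterm u -> GRing.rterm v ->
  exists2 P : {poly {poly R}}, P != 0 &
    forall t y, heval2 P t y != 0 -> \forall z \near y,
      Num.sg (GRing.eval [:: t; z] u - GRing.eval [:: t; z] v) =
      Num.sg (GRing.eval [:: t; y] u - GRing.eval [:: t; y] v).
Proof.
move=> /rterm_poly2[U UE] /rterm_poly2[V VE].
have UVE t y : GRing.eval [:: t; y] u - GRing.eval [:: t; y] v =
    heval2 (U - V) t y by rewrite -UE -VE /heval2 !hornerE.
have [UV0|UV0] := eqVneq (U - V) 0.
  exists 1; first exact: oner_neq0.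
  move=> t y _; apply: (@nearW _ (nbhs y)) => z.
  by rewrite !UVE UV0 /heval2 !horner0.
exists (U - V) => // t y /horner_sgr_near; apply: filterS => z.
by rewrite !UVE.
Qed.

Definition locally_constant_off_curve (R : realType) (G : ord.formula R) :=
  exists2 P : {poly {poly R}}, P != 0 &
    forall t y, heval2 P t y != 0 -> \forall z \near y,
      ord.qf_eval [:: t; z] G = ord.qf_eval [:: t; y] G.

(** If each of two formulas has its curve, the union of the curves serves for
    any boolean combination. *)
Lemma locally_constant_combine (R : realType) (G1 G2 G3 : ord.formula R)
    (op : bool -> bool -> bool) :
  (forall e, ord.qf_eval e G3 = op (ord.qf_eval e G1) (ord.qf_eval e G2)) ->
  locally_constant_off_curve G1 -> locally_constant_off_curve G2 ->
  locally_constant_off_curve G3.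
Proof.
move=> G3E [P P0 PE] [Q Q0 QE]; exists (P * Q); first by rewrite mulf_neq0.
move=> t y; rewrite /heval2 !hornerM mulf_eq0 negb_or => /andP[/PE Py /QE Qy].
by apply: filterS2 Py Qy => z; rewrite !G3E => -> ->.
Qed.

(** An atom that is not a truth constant compares two terms, so its truth depends
    only on the sign of their difference. *)
Lemma qf_eval_near (R : realType) (G : ord.formula R) :
  ord.qf_form G -> ord.rformula G -> locally_constant_off_curve G.
Proof.
elim: G => //=.
- move=> b _ _; exists 1; first exact: oner_neq0.
  by move=> t y _; exact: (@nearW _ (nbhs y)).
- move=> u v _ /andP[ru rv]; have [P P0 PE] := rterm_difference_sgr_near ru rv.
  exists P => // t y /PE; apply: filterS => z E.
  by rewrite -[LHS]subr_eq0 -[RHS]subr_eq0 -!(sgr_eq0 (_ - _)) E.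
- move=> u v _ /andP[ru rv]; have [P P0 PE] := rterm_difference_sgr_near ru rv.
  exists P => // t y /PE; apply: filterS => z E.
  by rewrite -[LHS]subr_lt0 -[RHS]subr_lt0 -!(sgr_lt0 (_ - _)) E.
- move=> u v _ /andP[ru rv]; have [P P0 PE] := rterm_difference_sgr_near ru rv.
  exists P => // t y /PE; apply: filterS => z E.
  by rewrite -[LHS]subr_le0 -[RHS]subr_le0 -!(sgr_le0 (_ - _)) E.
- move=> G1 IH1 G2 IH2 /andP[q1 q2] /andP[r1 r2].
  exact: (@locally_constant_combine R G1 G2 (ord.And G1 G2) andb (fun _ => erefl)
    (IH1 q1 r1) (IH2 q2 r2)).
- move=> G1 IH1 G2 IH2 /andP[q1 q2] /andP[r1 r2].
  exact: (@locally_constant_combine R G1 G2 (ord.Or G1 G2) orb (fun _ => erefl)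
    (IH1 q1 r1) (IH2 q2 r2)).
- move=> G1 IH1 G2 IH2 /andP[q1 q2] /andP[r1 r2].
  exact: (@locally_constant_combine R G1 G2 (ord.Implies G1 G2) implb (fun _ => erefl)
    (IH1 q1 r1) (IH2 q2 r2)).
- move=> G IH qG rG.
  exact: (@locally_constant_combine R G G (ord.Not G) (fun b _ => ~~ b)
    (fun _ => erefl) (IH qG rG) (IH qG rG)).
Qed.

(** * Zeros of a bivariate polynomial near the origin *)

Lemma horner_bounded (R : realFieldType) (p : {poly R}) :
  exists2 M : R, 0 <= M & forall y, 0 <= y <= 1 -> `|p.[y]| <= M.
Proof.
elim/poly_ind: p => [|p c [M M0 pM]].
  by exists 0 => // y _; rewrite horner0 normr0.
exists (M + `|c|) => [|y y01]; first by rewrite addr_ge0.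
rewrite hornerMXaddC (le_trans (ler_normD _ _)) // lerD2r normrM.
have /andP[y0 y1] := y01; rewrite -[leRHS]mulr1 ler_pM ?pM //.
by rewrite ger0_norm.
Qed.

Lemma heval2_bounded (R : realFieldType) (P : {poly {poly R}}) :
  exists2 M : R, 0 <= M &
    forall t y, 0 <= t <= 1 -> 0 <= y <= 1 -> `|heval2 P t y| <= M.
Proof.
rewrite /heval2; elim/poly_ind: P => [|P c [M M0 PM]].
  by exists 0 => // t y _ _; rewrite !horner0 normr0.
have [N N0 cN] := horner_bounded c.
exists (M + N) => [|t y t01 y01]; first by rewrite addr_ge0.
rewrite !hornerE (le_trans (ler_normD _ _)) // lerD ?cN // normrM.
have /andP[t0 t1] := t01; rewrite -[leRHS]mulr1 ler_pM ?PM //.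
by rewrite ger0_norm.
Qed.

Lemma factor_Xn (R : idomainType) (p : {poly R}) : p != 0 ->
  exists k q, q.[0] != 0 /\ p = q * 'X^k.
Proof.
move=> p0; have [k [q]] := multiplicity_XsubC p 0.
by rewrite p0 subr0 /= => q0 ->; exists k, q.
Qed.

Lemma split_constant_term (R : nzRingType) (p : {poly R}) :
  exists q, p = q * 'X + p.[0]%:P.
Proof.
have /factor_theorem[q E] : root (p - p.[0]%:P) 0.
  by rewrite /root !hornerE subrr.
by exists q; rewrite -['X]subr0 -E subrK.
Qed.

(** Write [P = t^j Q] with [Q(0, y)] a nonzero polynomial in [y], and
    [Q(0, y) = y^k u(y)] with [u(0) != 0].  On the zeros of [P] with [t > 0],
    [y^k u(y)] is a bounded multiple of [t], and [|u(y)| >= |u(0)| / 2] for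
    small [y].  The exponent [k.+1] also covers [k = 0], that is, [Q(0, 0)]
    nonzero, and is at least 1 so that it can be inverted. *)
Lemma polynomial_curve_holder (R : realFieldType) (P : {poly {poly R}}) :
  P != 0 ->
  exists (k : nat) (C eta : R), [/\ 0 < C, 0 < eta & forall t y,
    0 < t <= 1 -> 0 <= y <= eta -> heval2 P t y = 0 -> y ^+ k.+1 <= C * t].
Proof.
move=> /factor_Xn[j [Q [/factor_Xn[k [u [u0 QE]]] PQ]]].
have [Q1 Q1E] := split_constant_term Q.
have [u1 u1E] := split_constant_term u.
have [M M0 Q1M] := heval2_bounded Q1.
have [N N0 u1N] := horner_bounded u1.
pose d := `|u.[0]| / 2; have d0 : 0 < d by rewrite divr_gt0 ?normr_gt0.
exists k, ((M + 1) / d), (Num.min 1 (d / (N + 1))); split.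
- by rewrite divr_gt0 // ltr_wpDl.
- by rewrite lt_min ltr01 divr_gt0 // ltr_wpDl.
move=> t y /andP[t0 t1] /andP[y0]; rewrite le_min => /andP[y1 yd] Pty.
have Qty : heval2 Q t y = 0.
  apply/eqP; move/eqP: Pty; rewrite PQ /heval2 !hornerM !horner_exp !hornerE.
  by rewrite mulf_eq0 expf_eq0 (gt_eqF t0) andbF orbF.
have uy : d <= `|u.[y]|.
  have N1 : 0 < N + 1 by rewrite ltr_wpDl.
  have yN : `|u1.[y] * y| <= d.
    rewrite normrM (ger0_norm y0) (le_trans (ler_wpM2r y0 (u1N y _))) ?y0 //.
    move: yd; rewrite ler_pdivlMr // => /(le_trans _)->//.
    by rewrite mulrC ler_wpM2l // lerDl.
  have -> : u.[y] = u.[0] - - (u1.[y] * y).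
    by rewrite {1}u1E !hornerE; ring.
  apply: le_trans (lerB_dist _ _); rewrite normrN lerBrDr.
  by rewrite (le_trans (lerD (lexx d) yN)) // /d -splitr.
have yk : `|y ^+ k * u.[y]| <= M * t.
  move: Qty; rewrite /heval2 Q1E QE !hornerE => /eqP.
  rewrite addr_eq0 => /eqP E.
  rewrite mulrC -normrN -E normrM (gtr0_norm t0) ler_wpM2r ?(ltW t0) //.
  by apply: Q1M; rewrite ?y0 ?(ltW t0).
rewrite mulrAC ler_pdivlMr // exprS.
apply: le_trans (_ : y ^+ k * d <= _).
  by rewrite ler_wpM2r ?(ltW d0) // ler_piMl // exprn_ge0.
apply: le_trans (_ : y ^+ k * `|u.[y]| <= _).
  by rewrite ler_wpM2l // exprn_ge0.
rewrite -{1}(ger0_norm (exprn_ge0 k y0)) -normrM (le_trans yk) //.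
by rewrite ler_wpM2r ?(ltW t0) // lerDl.
Qed.

(** * Hoelder bound for definable sets of the plane *)

(** The truth of [H t] changes at [sup (H t)], from true below to false above,
    so this point lies on the algebraic curve off which the quantifier-free form
    of [H] is locally constant.  The smallness hypothesis places it in the
    neighbourhood of the origin where the curve is controlled. *)
Lemma definable_holder (R : realType) (F : ord.formula R) :
  let H t y := ord.holds [:: t; y] F in
  (forall t y y', 0 < t -> y' <= y -> H t y -> H t y') ->
  (forall eta : R, 0 < eta -> exists2 d, 0 < d &
     forall t y, 0 < t <= d -> H t y -> y <= eta) ->
  exists (k : nat) (C d : R), [/\ 0 < C, 0 < d & forall t y,
    0 < t <= d -> 0 <= y -> H t y -> y ^+ k.+1 <= C * t].
Proof.
move=> H down small; have [G [qG rG GF]] := quantifier_elimination F.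
have [P P0 PG] := qf_eval_near qG rG.
have [k [C [eta [C0 eta0 PC]]]] := polynomial_curve_holder P0.
have [d d0 dsmall] := small _ eta0.
exists k, C, (Num.min 1 d); split=> //; first by rewrite lt_min ltr01.
move=> t y /andP[t0]; rewrite le_min => /andP[t1 td] y0 Hty.
have ubH z : H t z -> z <= eta by apply: dsmall; rewrite t0.
have supH : has_sup (H t) by split; [exists y|exists eta].
set s := sup (H t).
have ys : y <= s by apply: sup_upper_bound.
have se : s <= eta by apply: ge_sup => //; exists y.
have below z : z < s -> H t z.
  rewrite -subr_gt0 => zs; have [w Hw] := sup_adherent zs supH.
  by rewrite subKr => /ltW zw; apply: down Hw.
have above z : s < z -> ~ H t z.
  by move=> sz Hz; have := sup_upper_bound supH Hz; rewrite leNgt sz.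
have Ps : heval2 P t s = 0.
  apply/eqP/negPn/negP => /PG /nbhs_ballP[e /= e0 He].
  have e2 : 0 < e / 2 by rewrite divr_gt0.
  have in_ball z : `|z| <= e / 2 -> ball s e (s + z).
    rewrite /ball /= opprD addNKr normrN => /le_lt_trans; apply.
    by rewrite ltr_pdivrMr // ltr_pMr // ltr1n.
  have Hl : H t (s - e / 2) by apply: below; rewrite ltrBlDr ltrDl.
  have Hr : ~ H t (s + e / 2) by apply: above; rewrite ltrDl.
  apply: Hr; apply/GF; rewrite He; last by apply: in_ball; rewrite gtr0_norm.
  rewrite -(He (s - e / 2)); first exact/GF.
  by apply: in_ball; rewrite normrN gtr0_norm.
have s0 := le_trans y0 ys.
apply: le_trans (PC t s _ _ Ps); rewrite ?t0 ?s0 //.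
by rewrite lerXn2r.
Qed.

(** * The gap as a function of the residual *)

(** Index, in an environment, of coordinate [i] of a point of the graph of a
    function: the argument occupies the variables from 3 on, and the value is
    variable [k]. *)
Definition graph_var (n k : nat) (i : 'I_(n + 1)) : nat :=
  if (i < n)%N then i.+3 else k.

Lemma real_graph_row (R : realType) (n k : nat) (h : 'rV[R]_n -> \bar R)
    (e : seq R) :
  real_graph h (\row_i e`_(graph_var k i)) <->
  (e`_k)%:E = h (\row_(i < n) e`_(i.+3)).
Proof.
rewrite /real_graph /=.
have -> : rsubmx (\row_i e`_(@graph_var n k i)) ord0 ord0 = e`_k.
  by rewrite !mxE /graph_var /= addn0 ltnn.
suff -> : lsubmx (\row_i e`_(@graph_var n k i)) = \row_(i < n) e`_(i.+3) by [].
by apply/rowP => i; rewrite !mxE /graph_var /= ltn_ord.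
Qed.

(** Variables 0 and 1 are [t] and [y], variable 2 is the value of [f] and the
    next [n] ones are the coordinates of [x]; all but [t] and [y] are quantified
    existentially. *)
Lemma gap_formula (R : realType) (n : nat) (f : 'rV[R]_n -> \bar R)
    (psi : 'rV[R]_n -> R) (c : R) :
  semialgebraic_fun f -> semialgebraic_fun (EFin \o psi) ->
  exists F : ord.formula R, forall t y : R,
    ord.holds [:: t; y] F <->
    exists x v, [/\ psi x = t, f x = v%:E & v + y <= c].
Proof.
move=> /(@semialgebraic_formula _ _ _ (@graph_var n 2))[Ff FfE].
move=> /(@semialgebraic_formula _ _ _ (@graph_var n 0))[Fp FpE].
exists (exists_vars (iota 2 n.+1) (ord.And Fp (ord.And Ff
  (ord.Le (GRing.Add (GRing.Var R 2) (GRing.Var R 1)) (GRing.Const c))))) => t y.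
rewrite holds_exists_vars /=; split.
  move=> [e ety [/FpE/real_graph_row[psix] [/FfE/real_graph_row fx vy]]].
  exists (\row_(i < n) e`_(i.+3)), e`_2.
  split=> //; first by rewrite -psix ety // inE mem_iota.
  by rewrite (_ : y = e`_1) // ety // inE mem_iota.
move=> [x [v [psix fx vy]]].
pose e := [:: t, y, v & [seq x ord0 i | i <- enum 'I_n]].
have ex : \row_(i < n) e`_(i.+3) = x.
  apply/rowP => i; rewrite mxE /= (nth_map i) ?size_enum_ord //.
  by rewrite nth_ord_enum.
exists e.
  case=> [|[|j]] //; rewrite inE mem_iota /= => nj.
  by rewrite !nth_default //= size_map size_enum_ord; move: nj; lia.
split; first by apply/FpE/real_graph_row; rewrite ex /= psix.
by split=> //; apply/FfE/real_graph_row; rewrite ex fx.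
Qed.

(** * Exact penalization and error bounds *)

Lemma gap_ge0 (R : realType) (T : Type) (S : set T) (f : T -> \bar R) (x : T) :
  (0 <= gap S f x)%E.
Proof. by rewrite /gap le_max lexx orbT. Qed.

Lemma gap_le (R : realType) (T : Type) (S : set T) (f : T -> \bar R) (x : T)
    (fs r : R) : inf_on S f = fs%:E -> 0 <= r ->
  (gap S f x <= r%:E)%E <-> (fs%:E <= f x + r%:E)%E.
Proof.
move=> fsE r0; rewrite /gap fsE ge_max lee_fin r0 andbT.
case: (f x) => [v| |].
- by rewrite -EFinB -EFinD !lee_fin lerBlDl.
- by rewrite /= leNye leey.
- by rewrite /= leye_eq leeNy_eq.
Qed.

Lemma inf_on_le (R : realType) (T : Type) (S : set T) (f : T -> \bar R) (x : T) :
  S x -> (inf_on S f <= f x)%E.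
Proof. by move=> Sx; apply: ereal_inf_lbound; exists x. Qed.

Section ExactPenalty.
Variables (R : realType) (n : nat) (S : set 'rV[R]_n).
Variables (f : 'rV[R]_n -> \bar R) (psi : 'rV[R]_n -> R).
Hypothesis fin_inf : inf_on S f \is a fin_num.
Hypothesis psi_residual : residual_function S psi.

Let fs := fine (inf_on S f).
Let fsE : inf_on S f = fs%:E.
Proof. by rewrite fineK. Qed.

Let psi_ge0 x : 0 <= psi x. Proof. exact: psi_residual.1. Qed.

Lemma penalized_on (alpha c : R) x : 0 < alpha -> S x ->
  penalized f psi alpha c x = f x.
Proof.
move=> a0 /psi_residual.2 px.
by rewrite /penalized px powR0 ?gt_eqF // mulr0 adde0.
Qed.

(** As the penalty is nonnegative, the positive part in the gap adds no
    constraint. *)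
Lemma error_bound_le_penalized (cstar alpha : R) : 0 < cstar ->
  error_bound S f psi cstar alpha <->
  forall x, (inf_on S f <= penalized f psi alpha cstar x)%E.
Proof.
move=> c0; rewrite fsE.
have gapE x : (gap S f x <= (cstar * psi x `^ alpha)%:E)%E <->
    (fs%:E <= penalized f psi alpha cstar x)%E.
  by apply: gap_le => //; rewrite mulr_ge0 ?powR_ge0 // ltW.
by split=> H x; apply/gapE/H.
Qed.

Lemma error_bound_mono (c c' alpha : R) : c <= c' ->
  error_bound S f psi c alpha -> error_bound S f psi c' alpha.
Proof.
by move=> cc' H x; apply: le_trans (H x) _; rewrite lee_fin ler_wpM2r ?powR_ge0.
Qed.

(** The penalty vanishes on [S], which gives one of the two inequalities between
    the infima; the other one is the error bound.  The same constant works in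
    both directions: an error bound for all [c > cstar] passes to the limit. *)
Lemma exact_penalty_error_bound (cstar alpha : R) : 0 < cstar -> 0 < alpha ->
  exact_penalty S f psi cstar alpha <-> error_bound S f psi cstar alpha.
Proof.
move=> c0 a0; split=> [ep|eb c cc].
  have ebc c : cstar < c -> error_bound S f psi c alpha.
    move=> cc; apply/error_bound_le_penalized; first exact: lt_trans cc.
    by move=> x; rewrite (ep _ cc); apply: inf_on_le.
  move=> x; apply/lee_addgt0Pr => e e0.
  (* Chosen so that the penalty at x grows by at most e. *)
  pose c := cstar + e / (psi x `^ alpha + 1).
  have p1 : 0 < psi x `^ alpha + 1 by rewrite ltr_wpDl ?powR_ge0.
  apply: le_trans (ebc c _ x) _; first by rewrite ltrDl divr_gt0.
  rewrite -EFinD lee_fin mulrDl lerD2l mulrAC ler_pdivrMr //.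
  by rewrite ler_wpM2l ?(ltW e0) // lerDl.
have c'0 := lt_trans c0 cc.
have /(error_bound_le_penalized _ c'0) le := error_bound_mono (ltW cc) eb.
apply/eqP; rewrite eq_le; apply/andP; split.
  by apply: le_ereal_inf_tmp => _ [x _ <-].
apply: le_ereal_inf_tmp => _ [x Sx <-].
by rewrite -(penalized_on c a0 Sx); apply: inf_on_le.
Qed.

(** A minimizer [x] of the penalized function outside [S] would satisfy
    [f x + c psi(x)^alpha = fs <= f x + cstar psi(x)^alpha], impossible as
    [cstar < c] and [psi x > 0]. *)
Lemma error_bound_argmin (cstar alpha c : R) : 0 < cstar -> 0 < alpha ->
  error_bound S f psi cstar alpha -> cstar < c ->
  argmin S f = argmin [set: 'rV[R]_n] (penalized f psi alpha c).
Proof.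
move=> c0 a0 eb cc.
have ep : inf_on S f = inf_on [set: 'rV[R]_n] (penalized f psi alpha c).
  exact: (exact_penalty_error_bound c0 a0).2 eb _ cc.
apply/seteqP; split=> x [Sx fx].
  by split=> //; rewrite -ep penalized_on.
have Sx' : S x; last by split=> //; rewrite ep -fx penalized_on.
apply: contrapT => nSx.
have px : 0 < psi x.
  by rewrite lt_neqAle psi_ge0 andbT eq_sym; apply/eqP => /psi_residual.2.
have := (error_bound_le_penalized alpha c0).1 eb x.
rewrite ep -fx /penalized; move: fx; rewrite -ep fsE /penalized.
case: (f x) => // v _; rewrite -!EFinD lee_fin lerD2l leNgt.
by rewrite ltr_pM2r ?powR_gt0 // cc.
Qed.

Lemma error_bound_cvg (cstar alpha : R) (x : nat -> 'rV[R]_n) :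
  0 < alpha -> error_bound S f psi cstar alpha ->
  (fun k => psi (x k)) @ \oo --> (0 : R) ->
  (fun k => gap S f (x k)) @ \oo --> (0%E : \bar R).
Proof.
move=> a0 eb px.
apply: (@squeeze_cvge _ _ _ _ (cst 0%E) _
    (fun k => (cstar * psi (x k) `^ alpha)%:E)).
- by apply: nearW => k; rewrite gap_ge0 eb.
- exact: cvg_cst.
apply: cvg_EFin; first exact: nearW.
rewrite -[X in _ --> X](mulr0 cstar); apply: cvgMl_tmp.
apply/cvgrPdist_le => e e0.
have d0 : 0 < e `^ alpha^-1 by rewrite powR_gt0.
move/cvgrPdist_le: px => /(_ _ d0); apply: filterS => k.
rewrite !sub0r !normrN !ger0_norm ?powR_ge0 // => pd.
rewrite (_ : e = (e `^ alpha^-1) `^ alpha).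
  by rewrite ge0_ler_powR ?nnegrE ?psi_ge0 ?powR_ge0 ?(ltW a0).
by rewrite -powRrM mulVf ?gt_eqF // powRr1 // ltW.
Qed.

(** If the gap stayed above [eta] on points of arbitrarily small residual, a
    sequence of such points would contradict the hypothesis on sequences. *)
Lemma gap_uniformly_small :
  (forall x : nat -> 'rV[R]_n,
    (fun k => psi (x k)) @ \oo --> (0 : R) ->
    (fun k => gap S f (x k)) @ \oo --> (0%E : \bar R)) ->
  forall eta : R, 0 < eta -> exists2 d : R, 0 < d &
    forall x, psi x <= d -> (gap S f x <= eta%:E)%E.
Proof.
move=> seq_small eta eta0; apply: contrapT => no_d.
have bad k : exists x, psi x <= k.+1%:R^-1 /\ (eta%:E < gap S f x)%E.
  apply: contrapT => nx; apply: no_d; exists k.+1%:R^-1 => // x px.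
  by rewrite leNgt; apply/negP => gx; apply: nx; exists x.
have [x xP] := choice bad.
have px : (fun k => psi (x k)) @ \oo --> (0 : R).
  apply: (@squeeze_cvgr _ _ _ _ (cst 0) (fun k => k.+1%:R^-1)).
  - by apply: nearW => k; rewrite psi_ge0 (xP k).1.
  - exact: cvg_cst.
  - exact: cvg_harmonic.
have /cvg_lim gx := seq_small x px.
have : (eta%:E <= limn (fun k => gap S f (x k)))%E.
  apply: lime_ge; last by apply: nearW => k; apply/ltW/(xP k).2.
  by apply/cvg_ex; exists 0%E; apply: seq_small.
by rewrite gx // lee_fin leNgt eta0.
Qed.

End ExactPenalty.

(** For [0 < psi x <= d] the Hoelder bound on the definable set of pairs
    (residual, value at most the gap) applies.  For [psi x > d] the gap is at
    most [fs - m], with [m] a lower bound of [f], and [psi(x)^alpha >= d^alpha].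
    The sum of the two constants serves in both ranges. *)
Lemma error_bound_of_gap_small (R : realType) (n : nat) (S : set 'rV[R]_n)
    (f : 'rV[R]_n -> \bar R) (psi : 'rV[R]_n -> R) :
  inf_on S f \is a fin_num -> (forall x, f x != -oo%E) ->
  residual_function S psi ->
  semialgebraic_fun f -> semialgebraic_fun (EFin \o psi) ->
  (exists m : R, forall x, (m%:E <= f x)%E) ->
  (forall eta : R, 0 < eta -> exists2 d : R, 0 < d &
    forall x, psi x <= d -> (gap S f x <= eta%:E)%E) ->
  exists cstar alpha : R,
    [/\ 0 < cstar, 0 < alpha <= 1 & error_bound S f psi cstar alpha].
Proof.
move=> fin_inf fNy [psi0 psiS] f_semi psi_semi [m fm] small.
have fsE : inf_on S f = (fine (inf_on S f))%:E by rewrite fineK.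
set fs := fine _ in fsE.
have [F FE] := gap_formula fs f_semi psi_semi.
have [t y y' _ yy' /FE[x [v [px fx vy]]]||k [C [d [C0 d0 Cd]]]] :=
    @definable_holder R F.
- by apply/FE; exists x, v; split=> //; apply: le_trans vy; rewrite lerD2l.
- move=> eta eta0; have [d d0 gd] := small _ eta0.
  exists d => // t y /andP[_ td] /FE[x [v [px fx vy]]].
  have := gd x; rewrite px => /(_ td) /(gap_le x fsE (ltW eta0)).
  by rewrite fx -EFinD lee_fin; move: vy; lra.
pose alpha : R := k.+1%:R^-1.
have a0 : 0 < alpha by rewrite invr_gt0.
have a1 : alpha <= 1 by rewrite invf_le1 // ler1n.
have K0 : 0 <= `|fs - m| / d `^ alpha by rewrite divr_ge0 ?powR_ge0.
exists (C `^ alpha + `|fs - m| / d `^ alpha), alpha; split.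
- by rewrite ltr_pwDl ?powR_gt0.
- by rewrite a0.
move=> x; apply/(gap_le x fsE).
  by rewrite mulr_ge0 ?powR_ge0 // addr_ge0 ?powR_ge0.
case fx : (f x) => [v| |]; last by move: (fNy x); rewrite fx.
  2: by rewrite leey.
rewrite -EFinD lee_fin -lerBlDl.
have [vfs|fsv] := leP fs v.
  apply: le_trans (_ : 0 <= _); first by rewrite subr_le0.
  by rewrite mulr_ge0 ?powR_ge0 // addr_ge0 ?powR_ge0.
have g0 : 0 <= fs - v by rewrite subr_ge0 ltW.
have px : 0 < psi x.
  rewrite lt_neqAle psi0 andbT eq_sym; apply/eqP => /psiS /(@inf_on_le _ _ _ f).
  by rewrite fsE fx lee_fin leNgt fsv.
have [pd|dp] := leP (psi x) d.
  have Hx : (fs - v) ^+ k.+1 <= C * psi x.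
    apply: Cd => //; first by rewrite px.
    by apply/FE; exists x, v; split=> //; rewrite addrC subrK.
  rewrite mulrDl; apply: ler_wpDr; first by rewrite mulr_ge0 ?powR_ge0.
  rewrite -powRM ?(ltW C0) //.
  rewrite -[leLHS](powRr1 g0) -(mulfV (_ : k.+1%:R != 0)) ?pnatr_eq0 //.
  rewrite powRrM powR_mulrn //.
  by rewrite ge0_ler_powR ?nnegrE ?(ltW a0) ?exprn_ge0 ?mulr_ge0 ?(ltW C0).
rewrite mulrDl; apply: ler_wpDl; first by rewrite mulr_ge0 ?powR_ge0.
have mv : m <= v by move: (fm x); rewrite fx lee_fin.
apply: le_trans (_ : `|fs - m| <= _).
  by apply: le_trans (ler_norm _); rewrite lerD2l lerN2.
rewrite mulrAC ler_pdivlMr ?powR_gt0 // ler_wpM2l //.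
by rewrite ge0_ler_powR ?nnegrE ?(ltW a0) ?(ltW d0) ?(ltW dp).
Qed.

(** * The equivalence *)

Unset Implicit Arguments.

Theorem theorem5p2 (R : realType) (n : nat) (S : set 'rV[R]_n)
    (f : 'rV[R]_n -> \bar R) (psi : 'rV[R]_n -> R)
    (S_nonempty : S !=set0)
    (S_semialg : semialgebraic_set S)
    (f_gtNy : forall x, f x != -oo%E)
    (f_semialg : semialgebraic_fun f)
    (fstar_finite : inf_on S f \is a fin_num)
    (psi_residual : residual_function S psi)
    (psi_semialg : semialgebraic_fun (EFin \o psi))
    (f_bounded_below : exists m : R, forall x, (m%:E <= f x)%E) :
  let property_i := exists cstar alpha : R,
    [/\ 0 < cstar, 0 < alpha <= 1 & exact_penalty S f psi cstar alpha] in
  let property_ii := exists cstar alpha : R,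
    [/\ 0 < cstar, 0 < alpha <= 1 & error_bound S f psi cstar alpha] in
  let property_iii := forall x : nat -> 'rV[R]_n,
    (fun k => psi (x k)) @ \oo --> (0 : R) ->
    (fun k => gap S f (x k)) @ \oo --> (0%E : \bar R) in
  [/\ property_i <-> property_ii,
      property_ii <-> property_iii &
      forall cstar alpha : R, 0 < cstar -> 0 < alpha <= 1 ->
        exact_penalty S f psi cstar alpha \/ error_bound S f psi cstar alpha ->
        forall c : R, cstar < c ->
          argmin S f = argmin [set: 'rV[R]_n] (penalized f psi alpha c)].
Proof.
have i_ii := exact_penalty_error_bound fstar_finite psi_residual.
split.
- split=> -[c [a [c0 /andP[a0 a1] H]]]; exists c, a; rewrite a0 a1.
    by split=> //; apply/i_ii.
  by split=> //; apply/i_ii.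
- split=> [[c [a [_ /andP[a0 _] eb]]] x|seq_small].
    exact: error_bound_cvg eb.
  apply: error_bound_of_gap_small => //.
  exact: gap_uniformly_small seq_small.
- move=> cstar a c0 /andP[a0 _] H c; apply: error_bound_argmin => //.
  by case: H => // /i_ii; apply.
Qed.
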